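(* Let $\mathbf A=\alpha\mathbf I+\mathbf S\in\mathbb R^{n\times n}$ with $\alpha\in\mathbb R$, $\alpha\neq 0$, $\mathbf S^\top=-\mathbf S$, let $\mathbf b\in\mathbb R^n$ be nonzero, and let $\ell=\max_k\dim\mathcal K_k(\mathbf S,\mathbf b)$. Then, for $\mathbf A\mathbf x=\mathbf b$ and with $\mathbf c=\mathbf b$ as second starting vector in USYMQR and USYMLQ, S$^3$MR is mathematically equivalent to USYMQR and S$^3$LQ is mathematically equivalent to USYMLQ; that is, $$\mathbf x_k^{\rm USYMQR}=\mathbf x_k^{\rm M}\quad(1\le k\le\ell-1),\qquad \mathbf x_k^{\rm USYMLQ}=\mathbf x_k^{\rm L}\quad(2\le k\le\ell).$$
   Context: Exact arithmetic is assumed. $\mathcal K_k(\mathbf M,\mathbf c)=\mathrm{span}\{\mathbf c,\mathbf M\mathbf c,\dots,\mathbf M^{k-1}\mathbf c\}$. The notation $\gamma\mathbf w:=\mathbf d$ means $\gamma=\|\mathbf d\|_2$; if $\gamma=0$ then stop, else $\mathbf w=\mathbf d/\gamma$. S$^3$MR iterate: $\mathbf x_k^{\rm M}=\mathrm{argmin}_{\mathbf x\in\mathcal K_k(\mathbf A,\mathbf b)}\|\mathbf b-\mathbf A\mathbf x\|_2$. S$^3$LQ iterate: $\mathbf x_k^{\rm L}$ is the vector of minimal Euclidean norm among all $\mathbf x\in\mathcal K_k(\mathbf A,\mathbf b)$ with $\mathbf b-\mathbf A\mathbf x\perp\mathcal K_{k-1}(\mathbf A,\mathbf b)$. Saunders--Simon--Yip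 tridiagonalization of $\mathbf A$ with starting vectors $\mathbf b,\mathbf c$: set $\widetilde{\mathbf u}_0=\widetilde{\mathbf v}_0=\mathbf 0$, $\beta_1\widetilde{\mathbf u}_1:=\mathbf b$, $\alpha_1\widetilde{\mathbf v}_1:=\mathbf c$, and for $k=1,2,\dots$: $\mathbf q:=\mathbf A\widetilde{\mathbf v}_k-\alpha_k\widetilde{\mathbf u}_{k-1}$, $\theta_k:=\widetilde{\mathbf u}_k^\top\mathbf q$, $\beta_{k+1}\widetilde{\mathbf u}_{k+1}:=\mathbf q-\theta_k\widetilde{\mathbf u}_k$, $\alpha_{k+1}\widetilde{\mathbf v}_{k+1}:=\mathbf A^\top\widetilde{\mathbf u}_k-\beta_k\widetilde{\mathbf v}_{k-1}-\theta_k\widetilde{\mathbf v}_k$. Let $\widetilde{\mathbf V}_k=[\widetilde{\mathbf v}_1\ \cdots\ \widetilde{\mathbf v}_k]$, and let $\widetilde{\mathbf T}_{k+1,k}$ and $\widetilde{\mathbf T}_{k-1,k}$ be the upper-left $(k+1)\times k$ and $(k-1)\times k$ submatrices of the tridiagonal matrix with diagonal $\theta_1,\theta_2,\dots$, subdiagonal $\beta_2,\beta_3,\dots$ and superdiagonal $\alpha_2,\alpha_3,\dots$. (For $\mathbf A=\alpha\mathbf I+\mathbf S$ and $\mathbf c=\mathbf b$ the vectors $\widetilde{\mathbf u}_k,\widetilde{\mathbf v}_k$ are produced for $1\le k\le\ell$.) USYMQR iterate: $\mathbf x_k^{\rm USYMQR}=\widetilde{\mathbf V}_k\widetilde{\mathbf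 z}_k$ with $\widetilde{\mathbf z}_k=\mathrm{argmin}_{\mathbf z\in\mathbb R^k}\|\beta_1\mathbf e_1-\widetilde{\mathbf T}_{k+1,k}\mathbf z\|_2$. USYMLQ iterate: $\mathbf x_k^{\rm USYMLQ}=\widetilde{\mathbf V}_k\mathbf z_k$, where $\mathbf z_k$ is the minimum Euclidean norm solution of $\widetilde{\mathbf T}_{k-1,k}\mathbf z=\beta_1\mathbf e_1$. *)

(* Defs.v *)
From mathcomp Require Import all_boot all_order all_algebra.
From mathcomp Require Import reals.

Set Implicit Arguments.
Unset Strict Implicit.
Unset Printing Implicit Defensive.

Import Order.TTheory GRing.Theory Num.Theory.

Local Open Scope ring_scope.

Definition dot (R : realType) (n : nat) (u v : 'cV[R]_n) : R :=
  (u^T *m v) 0 0.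

(* The norm that MathComp-Analysis puts on matrices is the maximum norm, hence
   this separate Euclidean norm. *)
Definition norm2 (R : realType) (n : nat) (v : 'cV[R]_n) : R :=
  Num.sqrt (\sum_i v i 0 ^+ 2).

Definition krylov (R : realType) (n : nat) (M : 'M[R]_n) (c : 'cV[R]_n)
    (k : nat) : {vspace 'cV[R]_n} :=
  <<[seq M ^+ i *m c | i <- iota 0 k]>>%VS.

Definition is_max_krylov_dim (R : realType) (n : nat) (M : 'M[R]_n)
    (c : 'cV[R]_n) (l : nat) : Prop :=
  (exists k, \dim (krylov M c k) = l) /\
  (forall k, (\dim (krylov M c k) <= l)%N).

Definition is_minimizer (R : realType) (T : Type) (D : T -> Prop) (f : T -> R)
    (x : T) : Prop :=
  D x /\ forall y, D y -> f x <= f y.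

(* [x] is the argmin of [f] over [D]: uniqueness is part of the notion, so that
   two iterates specified by [is_argmin] coincide as soon as one vector
   satisfies both specifications. *)
Definition is_argmin (R : realType) (T : Type) (D : T -> Prop) (f : T -> R)
    (x : T) : Prop :=
  unique (is_minimizer D f) x.

Definition is_S3MR (R : realType) (n : nat) (A : 'M[R]_n) (b : 'cV[R]_n)
    (k : nat) (x : 'cV[R]_n) : Prop :=
  is_argmin (fun y => y \in krylov A b k) (fun y => norm2 (b - A *m y)) x.

Definition is_S3LQ (R : realType) (n : nat) (A : 'M[R]_n) (b : 'cV[R]_n)
    (k : nat) (x : 'cV[R]_n) : Prop :=
  is_argmin
    (fun y => y \in krylov A b k /\
       forall w, w \in krylov A b k.-1 -> dot w (b - A *m y) = 0)
    (@norm2 R n) x.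

(* Saunders-Simon-Yip tridiagonalization. The state of index k >= 1 holds
   u_(k-1), u_k, v_(k-1), v_k, beta_k and alpha_k. *)
Record ssy_state (R : realType) (n : nat) := SSYState {
  ssy_uprev : 'cV[R]_n;
  ssy_ucur : 'cV[R]_n;
  ssy_vprev : 'cV[R]_n;
  ssy_vcur : 'cV[R]_n;
  ssy_bcur : R;
  ssy_acur : R }.

(* Since 0^-1 = 0, this is 0 when [d] is 0, where the process stops; see
   [ssy_produced]. *)
Definition normalize (R : realType) (n : nat) (d : 'cV[R]_n) : 'cV[R]_n :=
  (norm2 d)^-1 *: d.

Definition ssy_init (R : realType) (n : nat) (b c : 'cV[R]_n) :
    ssy_state R n :=
  SSYState 0 (normalize b) 0 (normalize c) (norm2 b) (norm2 c).

Definition ssy_q (R : realType) (n : nat) (A : 'M[R]_n) (s : ssy_state R n) :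
    'cV[R]_n :=
  A *m ssy_vcur s - ssy_acur s *: ssy_uprev s.

Definition ssy_thcur (R : realType) (n : nat) (A : 'M[R]_n)
    (s : ssy_state R n) : R :=
  dot (ssy_ucur s) (ssy_q A s).

Definition ssy_step (R : realType) (n : nat) (A : 'M[R]_n)
    (s : ssy_state R n) : ssy_state R n :=
  let du := ssy_q A s - ssy_thcur A s *: ssy_ucur s in
  let dv := A^T *m ssy_ucur s - ssy_bcur s *: ssy_vprev s
            - ssy_thcur A s *: ssy_vcur s in
  SSYState (ssy_ucur s) (normalize du) (ssy_vcur s) (normalize dv)
           (norm2 du) (norm2 dv).

(* Meaningful for k >= 1 only. *)
Definition ssy (R : realType) (n : nat) (A : 'M[R]_n) (b c : 'cV[R]_n)
    (k : nat) : ssy_state R n :=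
  iter k.-1 (ssy_step A) (ssy_init b c).

Definition ssy_v (R : realType) (n : nat) (A : 'M[R]_n) (b c : 'cV[R]_n)
    (k : nat) : 'cV[R]_n := ssy_vcur (ssy A b c k).

Definition ssy_beta (R : realType) (n : nat) (A : 'M[R]_n) (b c : 'cV[R]_n)
    (k : nat) : R := ssy_bcur (ssy A b c k).

Definition ssy_alpha (R : realType) (n : nat) (A : 'M[R]_n) (b c : 'cV[R]_n)
    (k : nat) : R := ssy_acur (ssy A b c k).

Definition ssy_theta (R : realType) (n : nat) (A : 'M[R]_n) (b c : 'cV[R]_n)
    (k : nat) : R := ssy_thcur A (ssy A b c k).

(* u_1, ..., u_k and v_1, ..., v_k are produced, i.e. none of the
   normalizations defining them triggered the stopping rule. *)
Definition ssy_produced (R : realType) (n : nat) (A : 'M[R]_n)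
    (b c : 'cV[R]_n) (k : nat) : Prop :=
  forall j : nat, (1 <= j <= k)%N ->
    ssy_beta A b c j != 0 /\ ssy_alpha A b c j != 0.

Definition ssy_V (R : realType) (n : nat) (A : 'M[R]_n) (b c : 'cV[R]_n)
    (k : nat) : 'M[R]_(n, k) :=
  \matrix_(i < n, j < k) ssy_v A b c j.+1 i 0.

(* Upper-left p x q submatrix of the tridiagonal matrix. Ordinals start at 0,
   the coefficients of the process at 1. *)
Definition ssy_T (R : realType) (n : nat) (A : 'M[R]_n) (b c : 'cV[R]_n)
    (p q : nat) : 'M[R]_(p, q) :=
  \matrix_(i < p, j < q)
    if (i == j :> nat) then ssy_theta A b c i.+1
    else if (i == j.+1 :> nat) then ssy_beta A b c i.+1
    else if (j == i.+1 :> nat) then ssy_alpha A b c j.+1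
    else 0.

Definition e1 (R : realType) (m : nat) : 'cV[R]_m :=
  \col_(i < m) (i == 0 :> nat)%:R.
Arguments e1 : clear implicits.

Definition is_USYMQR (R : realType) (n : nat) (A : 'M[R]_n) (b c : 'cV[R]_n)
    (k : nat) (x : 'cV[R]_n) : Prop :=
  ssy_produced A b c k /\
  exists z : 'cV[R]_k,
    is_argmin (fun _ => True)
      (fun y : 'cV[R]_k =>
         norm2 (ssy_beta A b c 1 *: e1 R k.+1 - ssy_T A b c k.+1 k *m y)) z /\
    x = ssy_V A b c k *m z.

Definition is_USYMLQ (R : realType) (n : nat) (A : 'M[R]_n) (b c : 'cV[R]_n)
    (k : nat) (x : 'cV[R]_n) : Prop :=
  ssy_produced A b c k /\
  exists z : 'cV[R]_k,
    is_argmin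
      (fun y : 'cV[R]_k =>
         ssy_T A b c k.-1 k *m y = ssy_beta A b c 1 *: e1 R k.-1)
      (@norm2 R k) z /\
    x = ssy_V A b c k *m z.

(* Main.v *)
Require Import Defs.
From mathcomp Require Import all_boot all_order all_algebra.
From mathcomp Require Import reals.

Set Implicit Arguments.
Unset Strict Implicit.
Unset Printing Implicit Defensive.

Import Order.TTheory GRing.Theory Num.Theory.
Local Open Scope ring_scope.

(** Write A = a I + S with S skew-symmetric and a != 0.  Started from c = b, the
    Saunders-Simon-Yip process is a Lanczos process for S in disguise: the
    vectors u_i (counted from 0) obey the three-term recurrence
      beta_(i+1) u_(i+1) = (-1)^i S u_i - beta_i u_(i-1),
    in which a does not occur, while v_i = (-1)^i u_i, alpha_i = beta_i and
    theta_i = (-1)^i a until breakdown ([ssy_lanczos], [ssy_thetaE]).  By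
    skew-symmetry the u_i are pairwise orthogonal ([lvec_orth]), and u_i is a
    unit vector when beta_i != 0.  Since u_0, ..., u_(k-1) span both K_k(A, b)
    and K_k(S, b) ([krylov_lanczos]), beta_i != 0 for all i < l ([lbeta_neq0]).

    Let U_p and V_q be the matrices of the first p vectors u_i and the first q
    vectors v_i.  Before breakdown, the p x q tridiagonal matrix T_(p,q) is
    U_p^T A V_q and beta_0 e_1 is U_p^T b ([ssy_TE], [ssy_rhsE]), and z |-> V_k z
    is an isometry of R^k onto
    K_k(A, b).  For the minimal residual methods, b - A V_k z lies in the range
    K_(k+1)(A, b) of U_(k+1), so it has the same norm as
    U_(k+1)^T (b - A V_k z) = beta_0 e_1 - T_(k+1,k) z.  For the minimal norm
    methods, b - A V_k z is orthogonal to K_(k-1)(A, b), the range of U_(k-1),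
    exactly when T_(k-1,k) z = beta_0 e_1.  In both cases the two optimization
    problems correspond under V_k ([is_argmin_image]).

    Each problem in R^k has exactly one solution because T_(k+1,k) is injective
    and T_(k-1,k) is surjective.  Both facts come from x^T A x = a |x|^2, which
    vanishes only at x = 0 ([dot_shift_eq0]). *)

(** * Euclidean geometry *)

Lemma dotE (R : realType) (n : nat) (u v : 'cV[R]_n) :
  dot u v = \sum_i u i 0 * v i 0.
Proof. by rewrite /dot mxE; apply: eq_bigr => i _; rewrite mxE. Qed.

Lemma dotC (R : realType) (n : nat) (u v : 'cV[R]_n) : dot u v = dot v u.
Proof. by rewrite !dotE; apply: eq_bigr => i _; rewrite mulrC. Qed.

Lemma dotDr (R : realType) (n : nat) (u v w : 'cV[R]_n) :
  dot u (v + w) = dot u v + dot u w.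
Proof. by rewrite /dot mulmxDr mxE. Qed.

Lemma dotZr (R : realType) (n : nat) (a : R) (u v : 'cV[R]_n) :
  dot u (a *: v) = a * dot u v.
Proof. by rewrite /dot -scalemxAr mxE. Qed.

Lemma dotZl (R : realType) (n : nat) (a : R) (u v : 'cV[R]_n) :
  dot (a *: u) v = a * dot u v.
Proof. by rewrite dotC dotZr dotC. Qed.

Lemma dotNr (R : realType) (n : nat) (u v : 'cV[R]_n) : dot u (- v) = - dot u v.
Proof. by rewrite -scaleN1r dotZr mulN1r. Qed.

Lemma dotBr (R : realType) (n : nat) (u v w : 'cV[R]_n) :
  dot u (v - w) = dot u v - dot u w.
Proof. by rewrite dotDr dotNr. Qed.

Lemma dotDl (R : realType) (n : nat) (u v w : 'cV[R]_n) :
  dot (u + v) w = dot u w + dot v w.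
Proof. by rewrite dotC dotDr !(dotC w). Qed.

Lemma dot0r (R : realType) (n : nat) (u : 'cV[R]_n) : dot u 0 = 0.
Proof. by rewrite /dot mulmx0 mxE. Qed.

Lemma dot_mull (R : realType) (m n : nat) (M : 'M[R]_(m, n))
    (x : 'cV[R]_n) (y : 'cV[R]_m) : dot (M *m x) y = dot x (M^T *m y).
Proof. by rewrite /dot trmx_mul mulmxA. Qed.

Lemma dot_ge0 (R : realType) (n : nat) (u : 'cV[R]_n) : 0 <= dot u u.
Proof. by rewrite dotE; apply: sumr_ge0 => i _; rewrite -expr2 sqr_ge0. Qed.

Lemma dot_eq0 (R : realType) (n : nat) (u : 'cV[R]_n) : dot u u = 0 -> u = 0.
Proof.
rewrite dotE => /eqP; rewrite psumr_eq0 => [/allP u0|i _]; last first.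
  by rewrite -expr2 sqr_ge0.
apply/matrixP => i j; rewrite ord1 mxE; apply/eqP.
by have := u0 i (mem_index_enum i); rewrite /= mulf_eq0 orbb.
Qed.

Lemma norm2E (R : realType) (n : nat) (u : 'cV[R]_n) :
  norm2 u = Num.sqrt (dot u u).
Proof. by rewrite dotE. Qed.

Lemma norm2_eq0 (R : realType) (n : nat) (u : 'cV[R]_n) :
  norm2 u = 0 -> u = 0.
Proof.
move/eqP; rewrite norm2E sqrtr_eq0 => u_le0; apply/dot_eq0/le_anti.
by rewrite u_le0 dot_ge0.
Qed.

Lemma norm2_0 (R : realType) (n : nat) : norm2 (0 : 'cV[R]_n) = 0.
Proof. by rewrite norm2E dot0r sqrtr0. Qed.

Lemma normalizeK (R : realType) (n : nat) (d : 'cV[R]_n) :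
  norm2 d *: normalize d = d.
Proof.
rewrite /normalize scalerA; have [/norm2_eq0 ->|d0] := eqVneq (norm2 d) 0.
  by rewrite scaler0.
by rewrite divff // scale1r.
Qed.

Lemma dot_normalize (R : realType) (n : nat) (d : 'cV[R]_n) :
  norm2 d != 0 -> dot (normalize d) (normalize d) = 1.
Proof.
move=> d0; rewrite /normalize dotZl dotZr mulrA -[dot d d]sqr_sqrtr ?dot_ge0 //.
by rewrite -norm2E -expr2 -exprMn mulVf // expr1n.
Qed.

Lemma norm2_sign (R : realType) (n m : nat) (d : 'cV[R]_n) :
  norm2 ((-1) ^+ m *: d) = norm2 d.
Proof. by rewrite !norm2E dotZl dotZr mulrA -expr2 sqrr_sign mul1r. Qed.

Lemma normalize_sign (R : realType) (n m : nat) (d : 'cV[R]_n) :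
  normalize ((-1) ^+ m *: d) = (-1) ^+ m *: normalize d.
Proof. by rewrite /normalize norm2_sign !scalerA mulrC. Qed.

Lemma norm2_isometry (R : realType) (m n : nat) (U : 'M[R]_(m, n))
    (z : 'cV[R]_n) : U^T *m U = 1%:M -> norm2 (U *m z) = norm2 z.
Proof. by move=> UU; rewrite !norm2E dot_mull mulmxA UU mul1mx. Qed.

(** By Pythagoras: if all values [g y] on the feasible set differ from [g z] by
    vectors orthogonal to [g z], then [z] minimizes the norm of [g], and [g]
    takes the value [g z] at every minimizer. *)
Lemma is_argmin_orthogonal (R : realType) (T : Type) (m : nat) (D : T -> Prop)
    (g : T -> 'cV[R]_m) (z : T) :
  D z ->
  (forall y, D y -> dot (g z) (g y - g z) = 0) ->
  (forall y, D y -> g y = g z -> z = y) ->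
  is_argmin D (fun y => norm2 (g y)) z.
Proof.
move=> Dz gz_orth g_inj.
have pyth y : D y -> dot (g y) (g y) =
    dot (g z) (g z) + dot (g y - g z) (g y - g z).
  move=> /gz_orth; rewrite -{2 3}[g y](subrK (g z)).
  move: (g y - g z) => d gzd; rewrite dotDl !dotDr.
  by rewrite (dotC d) gzd addr0 add0r addrC.
split; first split=> // y Dy.
  by rewrite !norm2E ler_wsqrtr // (pyth y) // lerDl dot_ge0.
move=> y [Dy y_min]; apply: g_inj => //; apply/eqP; rewrite -subr_eq0.
apply/eqP/dot_eq0/le_anti; rewrite dot_ge0 andbT.
by have := y_min z Dz; rewrite !norm2E ler_sqrt ?dot_ge0 // (pyth y) // gerDl.
Qed.

(** Transfer of an argmin along a map of one feasible set onto another that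
    preserves the objective; injectivity is not needed, since uniqueness is
    inherited through surjectivity. *)
Lemma is_argmin_image (R : realType) (T T' : Type) (phi : T -> T')
    (D : T -> Prop) (D' : T' -> Prop) (f : T -> R) (f' : T' -> R) (z : T) :
  (forall y, D y -> D' (phi y)) ->
  (forall y', D' y' -> exists2 y, D y & y' = phi y) ->
  (forall y, D y -> f' (phi y) = f y) ->
  is_argmin D f z -> is_argmin D' f' (phi z).
Proof.
move=> phiD phi_onto f'phi [[Dz z_min] z_uniq]; split.
  split=> [|_ /phi_onto[y Dy ->]]; first exact: phiD.
  by rewrite !f'phi // z_min.
move=> _ [/phi_onto[y Dy ->] y_min]; congr phi; apply: z_uniq; split=> // t Dt.
by have := y_min _ (phiD t Dt); rewrite !f'phi.
Qed.

(** * Least-squares and minimum-norm solutions *)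

Lemma unitmx_inj (R : realType) (n : nat) (G : 'M[R]_n) :
  (forall z : 'cV[R]_n, G *m z = 0 -> z = 0) -> G \in unitmx.
Proof.
move=> Ginj; rewrite -unitmx_tr -row_free_unit; apply: inj_row_free => v vG.
apply: trmx_inj; rewrite trmx0; apply: Ginj.
by rewrite -[G]trmxK -trmx_mul vG trmx0.
Qed.

Lemma unitmx_gram (R : realType) (m n : nat) (M : 'M[R]_(m, n)) :
  (forall z : 'cV[R]_n, M *m z = 0 -> z = 0) -> M^T *m M \in unitmx.
Proof.
move=> Minj; apply: unitmx_inj => z MMz; apply/Minj/dot_eq0.
by rewrite dot_mull mulmxA MMz dot0r.
Qed.

Lemma least_squares_argmin (R : realType) (m n : nat) (M : 'M[R]_(m, n))
    (c : 'cV[R]_m) :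
  (forall z : 'cV[R]_n, M *m z = 0 -> z = 0) ->
  exists z, is_argmin (fun _ => True) (fun y => norm2 (c - M *m y)) z.
Proof.
move=> Minj; have Gu := unitmx_gram Minj.
(* The solution of the normal equations M^T M z = M^T c. *)
exists (invmx (M^T *m M) *m (M^T *m c)).
set z := (X in is_argmin _ _ X).
have normal_eq : M^T *m (c - M *m z) = 0.
  by rewrite mulmxBr mulmxA /z mulKVmx // subrr.
apply: (@is_argmin_orthogonal _ _ _ _ (fun y => c - M *m y)) => // y _.
  have -> : c - M *m y - (c - M *m z) = M *m (z - y).
    by rewrite opprB addrC subrKA mulmxBr.
  by rewrite dotC dot_mull normal_eq dot0r.
move=> /addrI/oppr_inj Myz; apply/eqP; rewrite -subr_eq0; apply/eqP/Minj.
by rewrite mulmxBr Myz subrr.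
Qed.

Lemma min_norm_argmin (R : realType) (m n : nat) (M : 'M[R]_(m, n))
    (c : 'cV[R]_m) :
  (forall w : 'cV[R]_m, M^T *m w = 0 -> w = 0) ->
  exists z, is_argmin (fun y => M *m y = c) (@norm2 R n) z.
Proof.
move=> MTinj; have := unitmx_gram MTinj; rewrite trmxK => Gu.
(* The solution lying in the range of M^T, i.e. orthogonal to the kernel of M. *)
exists (M^T *m (invmx (M *m M^T) *m c)).
set z := (X in is_argmin _ _ X).
have Mz : M *m z = c by rewrite /z mulmxA mulKVmx.
apply: (@is_argmin_orthogonal _ _ _ _ id) => // y My.
by rewrite /= /z dot_mull trmxK mulmxBr My Mz subrr dot0r.
Qed.

(** * Column matrices and Krylov subspaces *)

(** The matrix with columns [f 0], ..., [f (k - 1)]. *)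
Definition cols (R : realType) (n : nat) (f : nat -> 'cV[R]_n) (k : nat) :
    'M[R]_(n, k) := \matrix_(i < n, j < k) f j i 0.

Lemma mul_cols (R : realType) (n : nat) (f : nat -> 'cV[R]_n) (k : nat)
    (z : 'cV[R]_k) : cols f k *m z = \sum_j z j 0 *: f j.
Proof.
apply/matrixP => i j; rewrite ord1 mxE summxE; apply: eq_bigr => h _.
by rewrite !mxE mulrC.
Qed.

Lemma span_iotaP (R : realType) (n : nat) (f : nat -> 'cV[R]_n) (k : nat)
    (y : 'cV[R]_n) :
  y \in <<[seq f i | i <- iota 0 k]>>%VS <-> exists z, y = cols f k *m z.
Proof.
have szX : size [seq f i | i <- iota 0 k] == k by rewrite size_map size_iota.
have nthX (i : 'I_k) : [seq f i | i <- iota 0 k]`_i = f i.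
  by rewrite (nth_map 0%N) ?size_iota // nth_iota.
split=> [yX | [z ->]]; last first.
  rewrite mul_cols; apply: memv_suml => i _; apply/memvZ/memv_span.
  by rewrite map_f // mem_iota /=.
exists (\col_i coord (Tuple szX) i y); rewrite mul_cols.
rewrite [LHS](@coord_span _ _ _ (Tuple szX) y yX).
by apply: eq_bigr => i _; rewrite mxE /= nthX.
Qed.

Lemma tr_cols_mul (R : realType) (n p q : nat) (f g : nat -> 'cV[R]_n)
    (i : 'I_p) (j : 'I_q) (M : 'M[R]_n) :
  ((cols f p)^T *m M *m cols g q) i j = dot (f i) (M *m g j).
Proof.
rewrite -mulmxA mxE dotE; apply: eq_bigr => h _; rewrite !mxE.
by congr (_ * _); apply: eq_bigr => t _; rewrite mxE.
Qed.

Lemma krylov_mul (R : realType) (n : nat) (M : 'M[R]_n)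
    (c y : 'cV[R]_n) (k : nat) :
  y \in krylov M c k -> M *m y \in krylov M c k.+1.
Proof.
move/span_iotaP => [z ->]; rewrite mul_cols mulmx_sumr.
apply: memv_suml => i _; rewrite -scalemxAr mulmxA; apply/memvZ/memv_span.
rewrite mulmxE -exprS.
by apply/mapP; exists i.+1 => //; rewrite mem_iota /= add0n ltnS.
Qed.

Lemma krylov_le (R : realType) (n : nat) (M : 'M[R]_n)
    (c : 'cV[R]_n) (j k : nat) :
  (j <= k)%N -> (krylov M c j <= krylov M c k)%VS.
Proof.
move=> jk; apply: sub_span => x /mapP[i]; rewrite mem_iota => /= ij ->.
by apply/mapP; exists i => //; rewrite mem_iota /= (leq_trans ij).
Qed.

Lemma krylov_start (R : realType) (n : nat) (M : 'M[R]_n)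
    (c : 'cV[R]_n) (k : nat) :
  c \in krylov M c k.+1.
Proof. by apply/memv_span; rewrite /= expr0 mul1mx inE eqxx. Qed.

(** * The skew-symmetric Lanczos process *)

(** State of index [i], counted from 0: the vectors [u_(i-1)] (0 for [i = 0])
    and [u_i], and the coefficient [beta_i]. *)
Record lanczos_state (R : realType) (n : nat) := LanczosState {
  lz_prev : 'cV[R]_n; lz_cur : 'cV[R]_n; lz_bcur : R }.

(** One step of the recurrence.  The sign [(-1) ^+ i] is the one that relates
    the two families of vectors of the Saunders-Simon-Yip process. *)
Definition lanczos_step (R : realType) (n : nat) (S : 'M[R]_n) (i : nat)
    (s : lanczos_state R n) : lanczos_state R n :=
  let d := (-1) ^+ i *: (S *m lz_cur s) - lz_bcur s *: lz_prev s in
  LanczosState (lz_cur s) (normalize d) (norm2 d).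

(** As in the Saunders-Simon-Yip process, normalization of 0 yields 0, so all
    vectors and coefficients after a breakdown are 0. *)
Fixpoint lanczos (R : realType) (n : nat) (S : 'M[R]_n) (b : 'cV[R]_n)
    (i : nat) : lanczos_state R n :=
  if i is j.+1 then lanczos_step S j (lanczos S b j)
  else LanczosState 0 (normalize b) (norm2 b).

(** The Lanczos vector [u_i]. *)
Definition lvec (R : realType) (n : nat) (S : 'M[R]_n) (b : 'cV[R]_n) (i : nat) :
  'cV[R]_n := lz_cur (lanczos S b i).

(** The vector [u_(i-1)], which is 0 for [i = 0]. *)
Definition lprev (R : realType) (n : nat) (S : 'M[R]_n) (b : 'cV[R]_n) (i : nat) :
  'cV[R]_n := lz_prev (lanczos S b i).

(** The Lanczos coefficient [beta_i]. *)
Definition lbeta (R : realType) (n : nat) (S : 'M[R]_n) (b : 'cV[R]_n) (i : nat) :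
  R := lz_bcur (lanczos S b i).

Section Lanczos.
Variables (R : realType) (n : nat) (S : 'M[R]_n) (b : 'cV[R]_n).
Local Notation u := (lvec S b).
Local Notation v := (fun i => (-1) ^+ i *: lvec S b i).
Local Notation up := (lprev S b).
Local Notation be := (lbeta S b).

(** The vector whose normalization is [u_(i+1)]. *)
Definition ldir i := (-1) ^+ i *: (S *m u i) - be i *: up i.

Lemma lvecS i : u i.+1 = normalize (ldir i). Proof. by []. Qed.
Lemma lbetaS i : be i.+1 = norm2 (ldir i). Proof. by []. Qed.

Lemma lprevS i : up i.+1 = u i. Proof. by []. Qed.

Lemma lbeta_vecS i : be i.+1 *: u i.+1 = ldir i.
Proof. by rewrite lvecS lbetaS normalizeK. Qed.

Lemma lbeta_vec0 : be 0 *: u 0 = b.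
Proof. exact: normalizeK. Qed.

Lemma mul_lvec i : S *m u i = (-1) ^+ i *: (be i.+1 *: u i.+1 + be i *: up i).
Proof. by rewrite lbeta_vecS subrK scalerA -expr2 sqrr_sign scale1r. Qed.

Lemma lvec_eq0 i : be i = 0 -> u i = 0.
Proof.
by case: i => [|i]; rewrite /lbeta /lvec /= /normalize => ->;
  rewrite invr0 scale0r.
Qed.

Lemma lbeta_stop i j : (i <= j)%N -> be i = 0 -> be j = 0.
Proof.
move=> /subnKC <-; elim: (j - i)%N => [|m IH] bi0; rewrite ?addn0 //.
rewrite addnS lbetaS /ldir (lvec_eq0 (IH bi0)) IH //.
by rewrite mulmx0 scaler0 scale0r subr0 norm2_0.
Qed.

Lemma dot_lvec i : be i != 0 -> dot (u i) (u i) = 1.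
Proof. by case: i => [|i] /dot_normalize. Qed.

Lemma lbeta_dot i : be i * dot (u i) (u i) = be i.
Proof.
by have [->|/dot_lvec ->] := eqVneq (be i) 0; rewrite ?mul0r ?mulr1.
Qed.

(** If [beta_i = 0] then [u_i] is not a unit vector, but [beta_(i+1)] vanishes
    as well. *)
Lemma lbetaS_dot i : be i.+1 * dot (u i) (u i) = be i.+1.
Proof.
have [bi0|/dot_lvec ->] := eqVneq (be i) 0; last by rewrite mulr1.
by rewrite (lbeta_stop (leqnSn i) bi0) mul0r.
Qed.

Hypothesis hS : S^T = - S.

Lemma dot_skew x : dot x (S *m x) = 0.
Proof.
have: dot x (S *m x) = - dot x (S *m x).
  by rewrite {1}dotC dot_mull hS mulNmx dotNr.
by move/eqP; rewrite -addr_eq0 -mulr2n mulrn_eq0 /= => /eqP.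
Qed.

(** Orthogonality holds for all indices, beyond a breakdown too. *)
Lemma lvec_orth i j : (i < j)%N -> dot (u i) (u j) = 0.
Proof.
elim/ltn_ind: j i => -[//|m] IH i; rewrite ltnS => im.
rewrite lvecS dotZr; suff -> : dot (u i) (ldir m) = 0 by rewrite mulr0.
rewrite dotBr !dotZr.
have prev_orth j : (j <= m)%N -> dot (up j) (u m) = 0.
  case: j => [|j] jm; first by rewrite dotC dot0r.
  exact: IH.
case: ltngtP im => // [im|->] _; last first.
  by rewrite dot_skew dotC prev_orth // !mulr0 subrr.
have -> : dot (u i) (S *m u m) = - dot (S *m u i) (u m).
  by rewrite dot_mull hS mulNmx dotNr opprK.
rewrite mul_lvec dotZl dotDl !(dotZl (be _)) [dot (up i) _]prev_orth ?(ltnW im) //.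
rewrite mulr0 addr0.
(* Only [i = m - 1] remains nontrivial: there the two terms, both equal to
   [beta_m] up to sign, cancel. *)
case: m im IH {prev_orth} => // m; rewrite lprevS ltnS leq_eqVlt.
case/orP=> [/eqP ->|im] IH.
  by rewrite lbeta_dot exprS mulN1r mulNr mulrN opprK mulrA -expr2 sqrr_sign
             mul1r lbetaS_dot subrr.
by rewrite !IH ?(ltnW im) // !mulr0 oppr0 mulr0 addr0.
Qed.

Lemma dot_lvecE i j : be i != 0 -> dot (u i) (u j) = (i == j)%:R.
Proof.
move=> bi; case: ltngtP => [/lvec_orth //|ji|<-]; last exact: dot_lvec.
by rewrite dotC lvec_orth.
Qed.

Lemma dot_lprev i j : be i != 0 -> dot (u i) (up j) = (j == i.+1)%:R.
Proof.
by case: j => [|j] bi; rewrite ?dot0r // lprevS dot_lvecE // eqSS eq_sym.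
Qed.

Lemma cols_lvec_orthonormal k :
  (forall i, (i < k)%N -> be i != 0) -> (cols u k)^T *m cols u k = 1%:M.
Proof.
move=> bk; apply/matrixP => i j; rewrite -[_^T]mulmx1 tr_cols_mul mul1mx mxE.
by rewrite dot_lvecE // bk.
Qed.

(** * The tridiagonalization of a shifted skew-symmetric matrix *)

Lemma ssy_thcur_lanczos a i :
  let s := SSYState (up i) (u i) (- (-1) ^+ i *: up i) ((-1) ^+ i *: u i)
             (be i) (be i) in
  ssy_thcur (a%:M + S) s = (-1) ^+ i * a * dot (u i) (u i).
Proof.
rewrite /ssy_thcur /ssy_q /= dotBr -scalemxAr !dotZr mulmxDl dotDr dot_skew.
rewrite mul_scalar_mx dotZr addr0 mulrA.
case: i => [|i]; first by rewrite dot0r mulr0 subr0.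
have -> : dot (u i.+1) (up i.+1) = 0 by rewrite lprevS dotC lvec_orth.
by rewrite mulr0 subr0.
Qed.

(** The state of the Saunders-Simon-Yip process for [a I + S], whatever [a]:
    the two families of vectors agree up to sign, and the two families of
    coefficients are equal. *)
Lemma ssy_lanczos a i :
  iter i (ssy_step (a%:M + S)) (ssy_init b b) =
  SSYState (up i) (u i) (- (-1) ^+ i *: up i) ((-1) ^+ i *: u i) (be i) (be i).
Proof.
elim: i => [|i IH]; first by rewrite /= /ssy_init !scaler0 expr0 scale1r.
(* [u i] is 0 or a unit vector. *)
have dotu : dot (u i) (u i) *: u i = u i.
  by have [/lvec_eq0 ->|/dot_lvec ->] := eqVneq (be i) 0;
    rewrite ?scaler0 ?scale1r.
rewrite iterS IH /ssy_step ssy_thcur_lanczos /ssy_q /=.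
have -> : (a%:M + S) *m ((-1) ^+ i *: u i) - be i *: up i
    - ((-1) ^+ i * a * dot (u i) (u i)) *: u i = ldir i.
  rewrite -[_ *: u i in X in _ - X]scalerA dotu -scalemxAr mulmxDl mul_scalar_mx.
  by rewrite scalerDr scalerA addrAC [X in X - _ - _]addrC addrK.
have -> : (a%:M + S)^T *m u i - be i *: (- (-1) ^+ i *: up i)
    - ((-1) ^+ i * a * dot (u i) (u i)) *: ((-1) ^+ i *: u i)
    = (-1) ^+ i.+1 *: ldir i.
  rewrite linearD /= tr_scalar_mx hS mulmxDl mul_scalar_mx mulNmx.
  rewrite /ldir.
  have -> : ((-1) ^+ i * a * dot (u i) (u i)) *: ((-1) ^+ i *: u i) = a *: u i.
    by rewrite scalerA mulrAC -scalerA dotu mulrAC -expr2 sqrr_sign mul1r.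
  rewrite addrAC [X in X - _ - _]addrC addrK exprS mulN1r scalerBr.
  by rewrite [X in _ = X - _]scalerA mulNr -expr2 sqrr_sign scaleN1r !scalerA mulrC.
by rewrite norm2_sign normalize_sign -lvecS -lbetaS lprevS exprS mulN1r opprK.
Qed.

Lemma ssy_vE a i : ssy_v (a%:M + S) b b i.+1 = (-1) ^+ i *: u i.
Proof. by rewrite /ssy_v /ssy ssy_lanczos. Qed.

Lemma ssy_betaE a i : ssy_beta (a%:M + S) b b i.+1 = be i.
Proof. by rewrite /ssy_beta /ssy ssy_lanczos. Qed.

Lemma ssy_alphaE a i : ssy_alpha (a%:M + S) b b i.+1 = be i.
Proof. by rewrite /ssy_alpha /ssy ssy_lanczos. Qed.

Lemma ssy_thetaE a i :
  ssy_theta (a%:M + S) b b i.+1 = (-1) ^+ i * a * dot (u i) (u i).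
Proof. by rewrite /ssy_theta /ssy ssy_lanczos ssy_thcur_lanczos. Qed.

Lemma ssy_VE a k : ssy_V (a%:M + S) b b k = cols (fun i => (-1) ^+ i *: u i) k.
Proof. by apply/matrixP => i j; rewrite !mxE ssy_vE mxE. Qed.

(** The tridiagonal matrix as a compression of [a I + S].  Only the left vectors
    have to be unit vectors. *)
Lemma ssy_TE a p q : (forall i, (i < p)%N -> be i != 0) ->
  ssy_T (a%:M + S) b b p q
  = (cols u p)^T *m (a%:M + S) *m cols (fun i => (-1) ^+ i *: u i) q.
Proof.
move=> bp; apply/matrixP => i j; rewrite tr_cols_mul mxE.
have bi := bp i (ltn_ord i).
rewrite mulmxDl mul_scalar_mx dotDr dotZr (dotZr (_ ^+ _)) -scalemxAr mul_lvec
        scalerA -expr2.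
rewrite sqrr_sign scale1r dotDr !(dotZr (be _)) !dot_lvecE // dot_lprev //.
rewrite ssy_thetaE ssy_betaE ssy_alphaE dot_lvec // mulr1.
have neqS m : (m == m.+1) = false by rewrite ltn_eqF.
have [<-|_] := eqVneq (i : nat) j.
  by rewrite neqS !mulr0 !addr0 mulr1 mulrC.
have [->|_] := eqVneq (i : nat) j.+1.
  by rewrite (ltn_eqF (leqW _)) // !mulr0 addr0 add0r mulr1.
by have [_|_] := eqVneq (j : nat) i.+1; rewrite !mulr0 ?mulr1 ?add0r ?addr0.
Qed.

(** * Krylov subspaces and breakdown *)

Lemma lvec_in_krylov a k : u k \in krylov (a%:M + S) b k.+1.
Proof.
set K := krylov (a%:M + S) b.
suff: u k \in K k.+1 /\ up k \in K k.+1 by case.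
elim: k => [|k [uk upk]].
  by rewrite mem0v memvZ // krylov_start.
rewrite lprevS; have uk1 := subvP (krylov_le _ _ (leqnSn k.+1)) _ uk.
have upk1 := subvP (krylov_le _ _ (leqnSn k.+1)) _ upk.
split=> //; rewrite lvecS memvZ // memvB ?memvZ //.
have -> : S *m u k = (a%:M + S) *m u k - a *: u k.
  by rewrite mulmxDl mul_scalar_mx addrC addKr.
by rewrite memvB ?memvZ ?krylov_mul.
Qed.

(** The right-hand side does not depend on the shift; [a = 0] is allowed and
    gives the Krylov subspaces of [S]. *)
Lemma krylov_lanczos a k :
  krylov (a%:M + S) b k = <<[seq u i | i <- iota 0 k]>>%VS.
Proof.
pose U k := <<[seq u i | i <- iota 0 k]>>%VS.
have uU i m : (i < m)%N -> u i \in U m.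
  by move=> im; apply/memv_span/mapP; exists i; rewrite ?mem_iota.
have U_mul m y : y \in U m -> (a%:M + S) *m y \in U m.+1.
  case/span_iotaP=> z ->; rewrite mul_cols mulmx_sumr memv_suml // => i _.
  rewrite -scalemxAr memvZ // mulmxDl mul_scalar_mx mul_lvec memvD //.
    by rewrite memvZ // uU // ltnW // ltnS.
  rewrite memvZ // memvD // memvZ ?uU ?ltnS //.
  case: i => -[|i] im /=; first exact: mem0v.
  by rewrite lprevS uU // ltnW // ltnW.
have pow_U i : (a%:M + S) ^+ i *m b \in U i.+1.
  elim: i => [|i IH]; last by rewrite exprS -mulmxE -mulmxA U_mul.
  by rewrite expr0 mul1mx -lbeta_vec0 memvZ ?uU.
apply/eqP; rewrite eqEsubv; apply/andP; split; apply/span_subvP => y /mapP[i].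
  rewrite mem_iota => /= ik ->; apply: subvP (pow_U i); apply: sub_span => x.
  case/mapP=> j; rewrite mem_iota => /= ji ->; apply/mapP; exists j => //.
  by rewrite mem_iota (leq_trans ji).
rewrite mem_iota => /= ik ->.
exact: subvP (krylov_le _ _ ik) _ (lvec_in_krylov a i).
Qed.

Lemma lbeta_neq0 l i : is_max_krylov_dim S b l -> (i < l)%N -> be i != 0.
Proof.
move=> [[k <-] _]; rewrite ltnNge; apply: contra => /eqP bi0.
(* All vectors from [u i] on vanish, so no Krylov subspace has dimension
   more than [i]. *)
have -> : krylov S b k = krylov (0%:M + S) b k by rewrite raddf0 add0r.
rewrite krylov_lanczos; set X := [seq u j | j <- iota 0 i].
suff kX : (<<[seq u j | j <- iota 0 k]>> <= <<X>>)%VS.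
  by rewrite (leq_trans (dimvS kX)) // (leq_trans (dim_span X)) // size_map
             size_iota.
apply/span_subvP => y /mapP[j _ ->]; have [ji|ij] := ltnP j i.
  by apply/memv_span/mapP; exists j; rewrite ?mem_iota.
by rewrite lvec_eq0 ?mem0v // (lbeta_stop ij).
Qed.

Lemma krylov_lvecP a k y :
  y \in krylov (a%:M + S) b k <-> exists z, y = cols u k *m z.
Proof. by rewrite krylov_lanczos; exact: span_iotaP. Qed.

(** Here [v] is the sequence of the right vectors [(-1) ^+ i *: u i]. *)
Lemma krylov_signed_lvecP a k y :
  y \in krylov (a%:M + S) b k <-> exists z, y = cols v k *m z.
Proof.
rewrite krylov_lvecP; split=> -[z ->]; exists (\col_j ((-1) ^+ j * z j 0)).
  rewrite !mul_cols; apply: eq_bigr => j _.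
  by rewrite mxE scalerA mulrAC -expr2 sqrr_sign mul1r.
rewrite !mul_cols; apply: eq_bigr => j _.
by rewrite mxE scalerA mulrC.
Qed.

Lemma cols_signed_lvec_orthonormal k :
  (forall i, (i < k)%N -> be i != 0) -> (cols v k)^T *m cols v k = 1%:M.
Proof.
move=> bk; apply/matrixP => i j; rewrite -[_^T]mulmx1 tr_cols_mul mul1mx mxE.
rewrite /= (dotZl (_ ^+ _)) (dotZr (_ ^+ _)) dot_lvecE ?bk //.
have [->|ij] := eqVneq i j.
  by rewrite eqxx mulr1 -expr2 sqrr_sign.
by rewrite (negPf (ij : (i : nat) != j)) !mulr0.
Qed.

Lemma ssy_rhsE a p : (forall i, (i < p)%N -> be i != 0) ->
  ssy_beta (a%:M + S) b b 1 *: e1 R p = (cols u p)^T *m b.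
Proof.
move=> bp; apply/matrixP => i j; rewrite ord1 ssy_betaE !mxE.
transitivity (dot (u i) b); last first.
  by rewrite dotE; apply: eq_bigr => h _; rewrite !mxE.
have -> : dot (u i) b = be 0 * dot (u i) (u 0) by rewrite -dotZr lbeta_vec0.
by rewrite dot_lvecE // bp.
Qed.

Lemma ssy_produced_lanczos a k : (forall i, (i < k)%N -> be i != 0) ->
  ssy_produced (a%:M + S) b b k.
Proof.
by move=> bk -[//|j] /andP[_ jk]; rewrite ssy_betaE ssy_alphaE !bk.
Qed.

Lemma dot_shift_eq0 a x : a != 0 -> dot x ((a%:M + S) *m x) = 0 -> x = 0.
Proof.
move=> a0; rewrite mulmxDl mul_scalar_mx dotDr dotZr dot_skew addr0 => /eqP.
by rewrite mulf_eq0 (negPf a0) => /eqP/dot_eq0.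
Qed.

(** * Equivalence of the iterates *)

Lemma usymqr_s3mr a k : a != 0 -> (forall i, (i < k.+1)%N -> be i != 0) ->
  exists x, is_USYMQR (a%:M + S) b b k x /\ is_S3MR (a%:M + S) b k x.
Proof.
move=> a0 bk1; have bk i (ik : (i < k)%N) : be i != 0 by rewrite bk1 // ltnW.
set A := a%:M + S; have TE := ssy_TE a k bk1.
have UU := cols_lvec_orthonormal bk1; have VV := cols_signed_lvec_orthonormal bk.
have norm_Ut r : r \in krylov A b k.+1 -> norm2 ((cols u k.+1)^T *m r) = norm2 r.
  by case/krylov_lvecP=> w ->; rewrite mulmxA UU mul1mx norm2_isometry.
have AV_K z : A *m (cols v k *m z) \in krylov A b k.+1.
  by apply/krylov_mul/krylov_signed_lvecP; exists z.
have T_inj (z : 'cV_k) : ssy_T A b b k.+1 k *m z = 0 -> z = 0.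
  rewrite TE -!mulmxA => Tz; have AVz : A *m (cols v k *m z) = 0.
    by apply: norm2_eq0; rewrite -norm_Ut // Tz norm2_0.
  rewrite -[z]mul1mx -VV -mulmxA (@dot_shift_eq0 a (cols v k *m z)) ?mulmx0 //.
  by rewrite AVz dot0r.
have [z z_argmin] := least_squares_argmin (ssy_beta A b b 1 *: e1 R k.+1) T_inj.
exists (cols v k *m z); split.
  split; first exact: ssy_produced_lanczos.
  by exists z; rewrite ssy_VE.
apply: (is_argmin_image (phi := fun z => cols v k *m z)) z_argmin
  => [y _|y' /krylov_signed_lvecP[y ->]|y _].
- by apply/krylov_signed_lvecP; exists y.
- by exists y.
rewrite TE ssy_rhsE // -!mulmxA -mulmxBr norm_Ut //.
by rewrite memvB // krylov_start.
Qed.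

Lemma usymlq_s3lq a k : a != 0 -> (forall i, (i < k)%N -> be i != 0) ->
  exists x, is_USYMLQ (a%:M + S) b b k x /\ is_S3LQ (a%:M + S) b k x.
Proof.
move=> a0 bk; have bk1 i (ik : (i < k.-1)%N) : be i != 0.
  by rewrite bk // (leq_trans ik) // leq_pred.
set A := a%:M + S; have TE := ssy_TE a k bk1.
have UU := cols_lvec_orthonormal bk1; have VV := cols_signed_lvec_orthonormal bk.
have TT_inj (w : 'cV_k.-1) : (ssy_T A b b k.-1 k)^T *m w = 0 -> w = 0.
  rewrite TE !trmx_mul trmxK -!mulmxA => Tw.
  have [z Uw] : exists z, cols u k.-1 *m w = cols v k *m z.
    (* The range of U_(k-1) is contained in that of V_k. *)
    apply/(krylov_signed_lvecP a)/(subvP (krylov_le _ _ (leq_pred k))).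
    by apply/krylov_lvecP; exists w.
  rewrite -[w]mul1mx -UU -mulmxA (@dot_shift_eq0 a (cols u k.-1 *m w)) ?mulmx0 //.
  by rewrite dotC dot_mull {1}Uw dot_mull Tw dot0r.
have [z z_argmin] := min_norm_argmin (ssy_beta A b b 1 *: e1 R k.-1) TT_inj.
exists (cols v k *m z); split.
  split; first exact: ssy_produced_lanczos.
  by exists z; rewrite ssy_VE.
have residual (y : 'cV_k) (w : 'cV_k.-1) :
    dot (cols u k.-1 *m w) (b - A *m (cols v k *m y)) =
    dot w (ssy_beta A b b 1 *: e1 R k.-1 - ssy_T A b b k.-1 k *m y).
  by rewrite dot_mull mulmxBr TE ssy_rhsE // !mulmxA.
apply: (is_argmin_image (phi := fun z => cols v k *m z)) z_argmin
  => [y Ty|y' [/krylov_signed_lvecP[y ->] y_orth]|y _].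
- split=> [|w /krylov_lvecP[z' ->]]; first by apply/krylov_signed_lvecP; exists y.
  by rewrite residual Ty subrr dot0r.
- exists y => //; apply/esym/eqP; rewrite -subr_eq0; apply/eqP/dot_eq0.
  by rewrite -residual y_orth //; apply/krylov_lvecP; eexists.
by rewrite norm2_isometry.
Qed.

End Lanczos.

Unset Implicit Arguments.

Theorem mainTheorem10 (R : realType) (n : nat) (alpha : R) (A S : 'M[R]_n)
    (b : 'cV[R]_n) (l : nat)
    (halpha : alpha != 0)
    (hS : S^T = - S)
    (hA : A = alpha%:M + S)
    (hb : b != 0)
    (hl : is_max_krylov_dim S b l) :
  (forall k : nat, (1 <= k <= l - 1)%N ->
     exists xQR xM : 'cV[R]_n,
       [/\ is_USYMQR A b b k xQR, is_S3MR A b k xM & xQR = xM]) /\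
  (forall k : nat, (2 <= k <= l)%N ->
     exists xLQ xL : 'cV[R]_n,
       [/\ is_USYMLQ A b b k xLQ, is_S3LQ A b k xL & xLQ = xL]).
Proof.
have beta_neq0 := lbeta_neq0 hl; rewrite hA; split=> k /andP[k_gt kl].
  have kl1 : (k < l)%N.
    by case: l kl {hl beta_neq0} => [|m]; rewrite ?subn1 //= leqNgt k_gt.
  have [i ik|x [xQR xM]] := @usymqr_s3mr _ _ _ b hS _ k halpha.
    by apply: beta_neq0; apply: leq_trans ik kl1.
  by exists x, x.
have [i ik|x [xLQ xL]] := @usymlq_s3lq _ _ _ b hS _ k halpha.
  by apply: beta_neq0; apply: leq_trans ik kl.
by exists x, x.
Qed.
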